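(* Let $q,A,B$ be complex numbers with $|q|<1$, $A\ne -1$, $B\ne -1$. Then $$\sum_{i,j\ge 0}(-1)^i q^{T_{i+j}+i}\frac{(AB)_i}{(q)_i}\left\{\frac{A^{1+j}}{1+A}+\frac{B^{1+j}}{1+B}\right\}+\frac{1-AB}{(1+A)(1+B)}\sum_{i,j\ge 0}(-1)^{i+j}q^{T_{i+j}+i}\frac{(AB)_i}{(q)_i}=(-Aq,-Bq,q;q)_\infty .$$
   Context: Notation: $T_n=\frac{n(n+1)}{2}$. For an integer $N\ge 0$, $(a)_N=(a;q)_N=\prod_{j=0}^{N-1}(1-aq^j)$ with $(a)_0=1$; for $|q|<1$, $(a)_\infty=(a;q)_\infty=\lim_{N\to\infty}(a;q)_N$; and $(a_1,a_2,\ldots,a_r;q)_\infty=(a_1;q)_\infty(a_2;q)_\infty\cdots(a_r;q)_\infty$. *)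

(* Defs.v *)
(* Complex numbers are R[i] for R : realType; their topology is the one that
   MathComp-Analysis puts on any numClosedFieldType, given by the norm. *)
From HB Require Import structures.
From mathcomp Require Import all_boot all_order all_algebra.
From mathcomp Require Import finmap.
From mathcomp Require Import all_classical all_reals.
From mathcomp Require Import topology normedtype sequences.
From mathcomp.analysis.showcase Require Import summability.
From mathcomp Require Import complex.

Set Implicit Arguments.
Unset Strict Implicit.
Unset Printing Implicit Defensive.

Import Order.TTheory GRing.Theory Num.Theory.
Import numFieldNormedType.Exports.

Local Open Scope classical_set_scope.
Local Open Scope ring_scope.

Definition triangular (n : nat) : nat := (n * n.+1)./2.

Definition qpoch (C : numClosedFieldType) (a q : C) (N : nat) : C :=
  \prod_(j < N) (1 - a * q ^+ j).

Definition qpoch_inf (C : numClosedFieldType) (a q : C) : C :=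
  limn (qpoch a q).

Definition qpochs_inf (C : numClosedFieldType) (s : seq C) (q : C) : C :=
  \prod_(a <- s) qpoch_inf a q.

(* [sum] is the limit of the finite partial sums along the directed set of
   finite subsets of the index type; over nat * nat this is the unordered
   double sum.  As [lim] is total, convergence is asserted separately. *)
Definition unordered_cvg (I : choiceType) (C : numClosedFieldType)
  (x : I -> C) : Prop := cvg (partial_sum x @ totally).

Definition unordered_sum (I : choiceType) (C : numClosedFieldType)
  (x : I -> C) : C := sum x.

(* Main.v *)
Require Import Defs.
From mathcomp Require Import all_boot all_order all_algebra.
From mathcomp Require Import finmap.
From mathcomp Require Import all_classical all_reals.
From mathcomp Require Import topology normedtype sequences.
From mathcomp.analysis.showcase Require Import summability.
From mathcomp Require Import complex.
From mathcomp Require Import ring zify.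
Import Order.TTheory GRing.Theory Num.Theory.
Import numFieldNormedType.Exports.
Local Open Scope classical_set_scope.
Local Open Scope ring_scope.

(** Both sides are generated by the same Bessel-type numbers. Write z = AB,
T_n for the triangular numbers, and

  b_k = sum_n z^n q^(T_n + T_(n+k)) / ((q)_n (q)_(n+k)),
  c_k = sum_i (-1)^i q^(T_(i+k)+i) (z)_i / (q)_i.

The product side: expanding (-Aq)_oo and (-Bq)_oo by Euler's formula
(-xq)_oo = sum_m q^(T_m) x^m / (q)_m and collecting the terms A^m B^n along the
diagonals m - n = k gives ([product_expansion])

  (-Aq)_oo (-Bq)_oo = D(A) + D(B) - b_0,   D(x) = sum_(k >= 0) b_k x^k.

The sum side: summing over i first leaves the series S(x) = sum_j c_j x^j at
x = A, B and -1. A limiting case of Heine's transformation is the relation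
c_k = (q)_oo (b_k + b_(k+1)) ([coef_bessel]), whence
x S(x) = (q)_oo ((1 + x) D(x) - b_0) ([coef_gen_bessel]). So the A-part and the
B-part of the first sum are (q)_oo (D(x) - b_0 / (1 + x)), the second sum is
S(-1) = (q)_oo b_0, and the stated multiple of it turns
- b_0 / (1 + A) - b_0 / (1 + B) into - b_0.

The analysis is a passage to the limit in finite identities: the q-binomial
theorem ([q_binomial]), a finite form of Heine's transformation
([finite_heine]) and a finite form of the diagonal expansion
([finite_product]), in which the q-binomial coefficients [N; m] tend to
1 / (q)_m. Each limit is an instance of Tannery's theorem ([tannery]). All
families that occur are dominated by geometric ones, because |q|^(T_n) a^n is
O(2^-n) for every a ([gauss_dominated]) and |(q)_n| stays between two positive
constants ([qpoch_bounds]). The same domination turns the unordered double sum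
into the iterated one ([unordered_iterated]). *)

Set Implicit Arguments.
Unset Strict Implicit.
Unset Printing Implicit Defensive.

(** * Geometrically dominated series *)

(** The one consequence of completeness that the argument uses. Isolating it lets
the rest be done over an abstract closed field, whose topology is the one that
its norm defines. *)
Definition geometric_complete (C : numClosedFieldType) : Prop :=
  forall (x : nat -> C) (K r : C), 0 <= r < 1 ->
    (forall n, `|x n| <= K * r ^+ n) -> cvgn (series x).

(** The real and imaginary parts are dominated by the same real geometric
series. *)
Lemma complex_geometric_complete (R : realType) : geometric_complete R[i].
Proof.
move=> x K r /andP[r0 r1] xle.
have [rho rE] : exists s : R, r = (s%:C)%C.
  by apply/complex_realP; rewrite ger0_real.
have K0 : 0 <= K by have := xle 0%N; rewrite expr0 mulr1; exact: le_trans.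
have [k kE] : exists s : R, K = (s%:C)%C.
  by apply/complex_realP; rewrite ger0_real.
rewrite rE ler0c in r0; rewrite rE -[1]/(1%:C)%C ltcR in r1; rewrite kE ler0c in K0.
have part (f : R[i] -> R) : (forall y, (`|f y|%:C)%C <= `|y|) ->
    cvgn (series (fun n => f (x n))).
  move=> fle; apply: normed_cvg; apply: (@series_le_cvg _ _ (geometric k rho))
    => [n|n|n|].
  - exact: normr_ge0.
  - by rewrite /= mulr_ge0 ?exprn_ge0.
  - rewrite /= -lecR; apply: le_trans (fle _) _; apply: le_trans (xle n) _.
    by rewrite kE rE -rmorphXn -rmorphM.
  - by apply: is_cvg_geometric_series; rewrite ger0_norm.
have normi : `|('i%C : R[i])| = 1.
  by rewrite normc_def /= expr0n expr1n add0r sqrtr1.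
have Im_le (y : R[i]) : (`|complex.Im y|%:C)%C <= `|y|.
  have := normc_ge_Re (y * 'i%C); rewrite ReiNIm normrN normrM.
  by rewrite normi mulr1.
have /cvg_ex[a /cvgrPdist_lt aP] := part (@complex.Re R) (@normc_ge_Re R).
have /cvg_ex[b /cvgrPdist_lt bP] := part (@complex.Im R) Im_le.
apply/cvg_ex; exists (a +i* b)%C; apply/cvgrPdist_lt => e e0.
have [d dE] : exists s : R, e = (s%:C)%C.
  by apply/complex_realP; rewrite gtr0_real.
have d2 : 0 < d / 2 by rewrite divr_gt0 // -ltcR -dE.
have sE n : series x n = ((series (fun m => complex.Re (x m)) n)
    +i* (series (fun m => complex.Im (x m)) n))%C.
  rewrite /series /=; elim: n => [|n IH]; first by rewrite !big_nil.
  by rewrite !big_nat_recr //= IH [x n]complexE; simpc.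
have subE u v : ((a +i* b) - (u +i* v) = (a - u)%:C + 'i * (b - v)%:C)%C.
  by simpc.
near=> n; rewrite sE subE.
apply: le_lt_trans (ler_normD _ _) _.
rewrite normrM normi mul1r.
rewrite !normc_def /= !expr0n !addr0 !sqrtr_sqr -rmorphD dE ltcR (splitr d).
by apply: ltrD; near: n; [exact: aP | exact: bP].
Unshelve. all: by end_near. Qed.

Lemma norm_cvg_le (C : numClosedFieldType) (u : nat -> C) (l c : C) :
  u @ \oo --> l -> (\forall n \near \oo, `|u n| <= c) -> `|l| <= c.
Proof.
move=> /cvgrPdist_lt ul uc; apply/ler_addgt0Pr => e e0.
near \oo => n; rewrite -[l](subrK (u n)) addrC.
apply: le_trans (ler_normD _ _) _; apply: lerD.
  by near: n.
by rewrite ltW //; near: n; exact: ul.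
Unshelve. all: by end_near. Qed.

Lemma cvg_finsum (C : numClosedFieldType) (I : Type) (s : seq I)
    (x : nat -> I -> C) (y : I -> C) :
  (forall i, x ^~ i @ \oo --> y i) ->
  (fun N => \sum_(i <- s) x N i) @ \oo --> \sum_(i <- s) y i.
Proof.
move=> xy; elim: s => [|i s IH].
  rewrite big_nil; under eq_fun do rewrite big_nil; exact: cvg_cst.
rewrite big_cons; under eq_fun do rewrite big_cons; exact: cvgD.
Qed.

Lemma geometric_tail (C : numClosedFieldType) (r : C) m n : 0 <= r < 1 ->
  \sum_(m <= k < n) r ^+ k <= r ^+ m / (1 - r).
Proof.
move=> /andP[r0 r1]; have r1' : 0 < 1 - r by rewrite subr_gt0.
have [nm|mn] := leqP n m.
  by rewrite big_geq // divr_ge0 ?exprn_ge0 // ltW.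
rewrite ler_pdivlMr // mulrC mulrBl mul1r mulr_sumr -sumrB.
rewrite (eq_bigr (fun k => - r ^+ k.+1 - - r ^+ k)); last first.
  by move=> k _; rewrite exprS opprK addrC.
by rewrite (telescope_sumr (fun k => - r ^+ k)) 1?ltnW // opprK addrC gerBl exprn_ge0.
Qed.

Section Dominated.
Variable C : numClosedFieldType.
Hypothesis completeC : geometric_complete C.

Lemma geometric_cvg0 (r K : C) : 0 <= r < 1 -> (fun n => K * r ^+ n) @ \oo --> 0.
Proof.
move=> r01; rewrite -(mulr0 K); apply: cvgMl_tmp.
suff cv : cvgn (series (fun n => r ^+ n)) by exact: cvg_series_cvg_0 cv.
apply: (completeC (K := 1) (r := r)) => // n.
by rewrite mul1r normrX ger0_norm //; case/andP: r01.
Qed.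

Lemma geometric_small (r K e : C) : 0 <= r < 1 -> 0 <= K -> 0 < e ->
  \forall n \near \oo, K * r ^+ n < e.
Proof.
move=> r01 K0 e0; have /cvgr0Pnorm_lt /(_ e e0) := geometric_cvg0 K r01.
apply: filterS => n; rewrite ger0_norm // mulr_ge0 ?exprn_ge0 //.
by case/andP: r01.
Qed.

Lemma dominated_sum (x : nat -> C) (K r : C) m n : 0 <= r < 1 ->
  (forall i, `|x i| <= K * r ^+ i) ->
  `|\sum_(m <= i < n) x i| <= K * r ^+ m / (1 - r).
Proof.
move=> r01 xle; apply: le_trans (ler_norm_sum _ _ _) _.
have K0 : 0 <= K by have := xle 0%N; rewrite expr0 mulr1; exact: le_trans.
apply: (le_trans (y := \sum_(m <= i < n) K * r ^+ i)).
  by apply: ler_sum => i _.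
by rewrite -mulr_sumr -mulrA ler_wpM2l // geometric_tail.
Qed.

Lemma dominated_series (x : nat -> C) (K r : C) : 0 <= r < 1 ->
  (forall i, `|x i| <= K * r ^+ i) -> `|limn (series x)| <= K / (1 - r).
Proof.
move=> r01 xle; apply: (@norm_cvg_le _ (series x)).
  exact: completeC r01 xle.
by near=> n; have := dominated_sum 0 n r01 xle; rewrite expr0 mulr1.
Unshelve. all: by end_near. Qed.

Lemma dominated_tail (x : nat -> C) (K r : C) m : 0 <= r < 1 ->
  (forall i, `|x i| <= K * r ^+ i) ->
  `|limn (series x) - series x m| <= K * r ^+ m / (1 - r).
Proof.
move=> r01 xle; apply: (@norm_cvg_le _ (fun n => series x n - series x m)).
  by apply: cvgB; [exact: completeC r01 xle | exact: cvg_cst].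
near=> n; rewrite sub_series_geq; first exact: dominated_sum.
by near: n; exact: nbhs_infty_ge.
Unshelve. all: by end_near. Qed.

(** Tannery's theorem: beyond an index m chosen uniformly in N, both sums are
small by domination, and the first m terms converge one by one. The length h N
is left free because q-binomial sums have N + 1 terms and squares have side N. *)
Lemma tannery (h : nat -> nat) (x : nat -> nat -> C) (y : nat -> C) (K r : C) :
  0 <= r < 1 -> (forall N, (N <= h N)%N) ->
  (forall N n, `|x N n| <= K * r ^+ n) -> (forall n, x ^~ n @ \oo --> y n) ->
  (fun N => \sum_(n < h N) x N n) @ \oo --> limn (series y).
Proof.
move=> r01 hN xle xy.
have yle n : `|y n| <= K * r ^+ n.
  by apply: (norm_cvg_le (xy n)); near=> N; exact: xle.
have K0 : 0 <= K by have := yle 0%N; rewrite expr0 mulr1; exact: le_trans.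
have r1 : 0 < 1 - r by rewrite subr_gt0; case/andP: r01.
apply/cvgrPdist_lt => e e0.
have e3 : 0 < e / 3 by rewrite divr_gt0.
have e3r : 0 < e / 3 * (1 - r) by rewrite mulr_gt0.
have [m _ /(_ _ (leqnn m)) /=] := geometric_small r01 K0 e3r.
rewrite -ltr_pdivrMr // => mP.
have /cvgrPdist_lt /(_ _ e3) fin := cvg_finsum (s := index_iota 0 m) xy.
near=> N.
have mN : (m <= h N)%N.
  by apply: leq_trans (hN N); near: N; exact: nbhs_infty_ge.
rewrite -(big_mkord xpredT (fun n => x N n)) (big_cat_nat (leq0n m) mN) //=.
set S := limn _; set u := \sum_(0 <= i < m) x N i; set v := \sum_(m <= i < _) _.
have -> : S - (u + v) = (S - series y m) + (series y m - u) - v by ring.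
rewrite [X in _ < X](_ : e = e / 3 + e / 3 + e / 3); last by field.
apply: le_lt_trans (ler_normB _ _) _; apply: ltrD.
  apply: le_lt_trans (ler_normD _ _) _; apply: ltrD.
    exact: le_lt_trans (dominated_tail m r01 yle) mP.
  by rewrite /u; near: N.
exact: le_lt_trans (dominated_sum _ _ r01 (xle N)) mP.
Unshelve. all: by end_near. Qed.

End Dominated.

(** * Unordered double sums *)

#[local] Existing Instance totally_filter.

Definition square (N : nat) : {fset nat * nat} :=
  [fset p in [seq (i, j) | i <- iota 0 N, j <- iota 0 N]]%fset.

Lemma in_square N p : (p \in square N) = (p.1 < N)%N && (p.2 < N)%N.
Proof.
rewrite !inE /=; case: p => i j /=; apply/allpairsP/andP => /=.
  by case=> -[a b] /=; rewrite !mem_iota /= => -[aN bN [-> ->]].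
by move=> [iN jN]; exists (i, j); rewrite !mem_iota.
Qed.

Lemma sum_square (C : zmodType) (f : nat * nat -> C) N :
  \sum_(p <- square N) f p = \sum_(j < N) \sum_(i < N) f (val i, val j).
Proof.
rewrite exchange_big /= -(big_mkord xpredT (fun i => \sum_(j < N) f (i, val j))).
under [RHS]eq_bigr => i _ do rewrite -(big_mkord xpredT (fun j => f (i, j))).
rewrite /index_iota subn0 -(big_allpairs (F := f)).
apply: perm_big; apply: uniq_perm; first exact: fset_uniq.
  by apply: allpairs_uniq; rewrite ?iota_uniq // => -[a b] [c d].
by move=> p; rewrite !inE.
Qed.

Lemma sub_square (J : {fset nat * nat}) : exists M, forall N, (M <= N)%N ->
  (J `<=` square N)%fset.
Proof.
exists (\max_(p <- J) maxn p.1 p.2).+1 => N MN.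
apply/fsubsetP => p pJ; rewrite in_square -gtn_max.
apply: leq_trans MN; rewrite ltnS.
exact: (leq_bigmax_seq (F := fun p => maxn p.1 p.2)).
Qed.

Lemma partial_sumE (C : zmodType) (I : choiceType) (f : I -> C) (J : {fset I}) :
  partial_sum f J = \sum_(p <- J) f p.
Proof. by rewrite /partial_sum big_seq_fsetE. Qed.

Section Unordered.
Variable C : numClosedFieldType.
Hypothesis completeC : geometric_complete C.

(** Partial sums over squares converge to the iterated sum by Tannery's theorem. A
finite set between the squares of sides N and M adds to the smaller one terms
of total norm at most K (s_M^2 - s_N^2), with s_N the partial sums of the
geometric series, and this is small uniformly in M. *)
Lemma unordered_iterated (f : nat * nat -> C) (K r : C) : 0 <= r < 1 ->
  (forall i j, `|f (i, j)| <= K * r ^+ i * r ^+ j) ->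
  partial_sum f @ totally -->
    limn (series (fun j => limn (series (fun i => f (i, j))))).
Proof.
move=> r01 fle; set S := limn _.
have /andP[r0 r1] := r01; have r1' : 0 < 1 - r by rewrite subr_gt0.
have K0 : 0 <= K by have := fle 0%N 0%N; rewrite !expr0 !mulr1; exact: le_trans.
have fle' j i : `|f (i, j)| <= (K * r ^+ j) * r ^+ i by rewrite mulrAC.
pose s N : C := \sum_(k < N) r ^+ k.
have s0 N : 0 <= s N by apply: sumr_ge0 => k _; rewrite exprn_ge0.
have sle N : s N <= (1 - r)^-1.
  by rewrite /s -(big_mkord xpredT (fun k => r ^+ k)) -[leRHS]mul1r
    -(expr0 r) geometric_tail.
have sq : (fun N => \sum_(j < N) \sum_(i < N) f (val i, val j)) @ \oo --> S.
  apply: (tannery completeC (h := id) (x := fun N j => \sum_(i < N) f (val i, j))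
    (K := K / (1 - r)) r01) => // [N j|j].
    rewrite -(big_mkord xpredT (fun i => f (i, j))) mulrAC.
    by have := dominated_sum 0 N r01 (fle' j); rewrite expr0 mulr1.
  under eq_fun do rewrite -(big_mkord xpredT (fun i => f (i, _))).
  exact: completeC r01 (fle' j).
pose g p : C := K * r ^+ p.1 * r ^+ p.2.
have gE N : \sum_(p <- square N) g p = K * s N ^+ 2.
  rewrite sum_square /g /= expr2 mulrA [in RHS]mulr_sumr.
  by apply: eq_bigr => j _; rewrite -mulr_suml -mulr_sumr.
apply/cvgrPdist_lt => e e0.
have e2 : 0 < e / 2 by rewrite divr_gt0.
have e2r : 0 < e / 2 * (1 - r) ^+ 2 by rewrite mulr_gt0 // exprn_gt0.
have K2 : 0 <= K * 2 by rewrite mulr_ge0.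
have /cvgrPdist_lt /(_ _ e2) sqe := sq.
have small := geometric_small completeC r01 K2 e2r.
near \oo => N.
have sqN : `|S - \sum_(j < N) \sum_(i < N) f (val i, val j)| < e / 2 by near: N.
have smallN : K * 2 * r ^+ N < e / 2 * (1 - r) ^+ 2 by near: N.
exists (square N) => // J /= NJ.
have [M0 JM0] := sub_square J; pose M := maxn M0 N.
have JM : (J `<=` square M)%fset by apply: JM0; rewrite leq_maxl.
have NM : (square N `<=` square M)%fset.
  apply/fsubsetP => p; rewrite !in_square => /andP[p1 p2].
  by rewrite !(leq_trans _ (leq_maxr M0 N)).
rewrite partial_sumE -(subrK (\sum_(p <- square N) f p) S) -addrA {1}sum_square.
rewrite [e](splitr e); apply: le_lt_trans (ler_normD _ _) _.
apply: ltr_leD => //.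
(* Extended by zero, both sums range over the large square; their terms differ
   only outside the small one, where they are dominated by g. *)
have onM (X : {fset nat * nat}) (u : nat * nat -> C) : (X `<=` square M)%fset ->
    \sum_(p <- X) u p = \sum_(p <- square M) (if p \in X then u p else 0).
  move=> XM; rewrite -(big_fset_incl _ XM) => [|p _ /negbTE ->//].
  by apply: eq_big_seq => p ->.
apply: (le_trans (y := \sum_(p <- square M) g p - \sum_(p <- square N) g p)).
  rewrite (onM _ f NM) (onM _ f JM) (onM _ g NM) -!sumrB.
  apply: le_trans (ler_norm_sum _ _ _) _; apply: ler_sum => -[i j] _.
  have g0 : 0 <= g (i, j) by rewrite /g !mulr_ge0 ?exprn_ge0.
  have fg : `|f (i, j)| <= g (i, j) by exact: fle.
  case: ifP => [/(fsubsetP NJ) -> | _]; first by rewrite !subrr normr0.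
  by rewrite sub0r normrN subr0; case: ifP => // _; rewrite normr0.
rewrite !gE -mulrBr subr_sqr.
have sMN : 0 <= s M - s N <= r ^+ N / (1 - r).
  have -> : s M - s N = \sum_(N <= k < M) r ^+ k.
    rewrite /s -!(big_mkord xpredT (fun k => r ^+ k)).
    have NM' : (N <= M)%N by exact: leq_maxr.
    by rewrite (big_cat_nat (leq0n N) NM') /= [LHS]addrC addKr.
  by rewrite geometric_tail // andbT sumr_ge0 // => k _; rewrite exprn_ge0.
have /andP[sMN0 sMN1] := sMN.
have sD : s M + s N <= 2 / (1 - r).
  by rewrite mulrDl mul1r; apply: lerD; exact: sle.
apply: (le_trans (y := K * (r ^+ N / (1 - r) * (2 / (1 - r))))).
  by rewrite ler_wpM2l // ler_pM // addr_ge0.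
have -> : K * (r ^+ N / (1 - r) * (2 / (1 - r))) = K * 2 * r ^+ N / (1 - r) ^+ 2.
  by field; rewrite gt_eqF.
by rewrite ler_pdivrMr ?exprn_gt0 // ltW.
Unshelve. all: by end_near. Qed.
End Unordered.

(** * Finite q-identities *)

Lemma triangularE n : triangular n = 'C(n.+1, 2).
Proof. by rewrite bin2 /triangular mulnC. Qed.

Lemma bin2D m n : 'C(m + n, 2) = ('C(m, 2) + 'C(n, 2) + m * n)%N.
Proof.
elim: n => [|n IH]; first by rewrite !addn0 muln0 addn0.
by rewrite addnS !binS !bin1 IH; lia.
Qed.

Lemma triangularD m n :
  triangular (m + n) = (triangular m + triangular n + m * n)%N.
Proof. by rewrite !triangularE -addnS bin2D !binS !bin1; lia. Qed.

Lemma triangularS n : triangular n.+1 = (triangular n + n.+1)%N.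
Proof. by rewrite !triangularE [in LHS]binS bin1. Qed.

Lemma triangular_bin n : triangular n = ('C(n, 2) + n)%N.
Proof. by rewrite triangularE binS bin1. Qed.

Section FiniteIdentities.
Variable C : numClosedFieldType.

Lemma qpochS (a q : C) n : qpoch a q n.+1 = qpoch a q n * (1 - a * q ^+ n).
Proof. by rewrite /qpoch big_ord_recr. Qed.

Lemma qpoch0 (a q : C) : qpoch a q 0 = 1.
Proof. by rewrite /qpoch big_ord0. Qed.

Lemma qpochD (a q : C) m n :
  qpoch a q (m + n) = qpoch a q m * qpoch (a * q ^+ m) q n.
Proof.
elim: n => [|n IH]; first by rewrite addn0 qpoch0 mulr1.
by rewrite addnS !qpochS IH exprD !mulrA.
Qed.

(** The Gaussian binomial coefficient, as a quotient of q-factorials rather than by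
the Pascal recursion, so that its limit as n grows can be read off. *)
Definition qbinom (q : C) n m : C :=
  if (m <= n)%N then qpoch q q n / (qpoch q q m * qpoch q q (n - m)) else 0.

Variable q : C.
Hypothesis qpoch_neq0 : forall n, qpoch q q n != 0.

Lemma qbinom_small n m : (n < m)%N -> qbinom q n m = 0.
Proof. by rewrite /qbinom ltnNge => /negbTE ->. Qed.

Lemma qbinom0 n : qbinom q n 0 = 1.
Proof. by rewrite /qbinom leq0n subn0 qpoch0 mul1r divff. Qed.

Lemma qbinomn n : qbinom q n n = 1.
Proof. by rewrite /qbinom leqnn subnn qpoch0 mulr1 divff. Qed.

Lemma qbinomD n m :
  qbinom q (m + n) m = qpoch q q (m + n) / (qpoch q q m * qpoch q q n).
Proof. by rewrite /qbinom leq_addr addKn. Qed.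

Lemma qbinomS n m : (m <= n)%N ->
  qbinom q n.+1 m.+1 = qbinom q n m.+1 + q ^+ (n - m) * qbinom q n m.
Proof.
rewrite leq_eqVlt => /predU1P[<-|].
  by rewrite !qbinomn qbinom_small // subnn expr0 mulr1 add0r.
move=> /subnKC <-; set d := (n - _)%N.
have -> : (m.+1 + d - m = d.+1)%N by lia.
have -> : qbinom q (m.+1 + d).+1 m.+1
    = qpoch q q (m.+1 + d).+1 / (qpoch q q m.+1 * qpoch q q d.+1).
  by rewrite -addnS qbinomD.
have -> : qbinom q (m.+1 + d) m
    = qpoch q q (m.+1 + d) / (qpoch q q m * qpoch q q d.+1).
  by rewrite addSnnS qbinomD.
rewrite qbinomD.
have := qpoch_neq0 m.+1; have := qpoch_neq0 d.+1.
rewrite !qpochS !mulf_eq0 !negb_or -!exprS => /andP[nd nqd] /andP[nm nqm].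
rewrite -addnS exprD.
field.
by rewrite nm nd nqm nqd.
Qed.

(** Gauss's q-binomial theorem, by the q-Pascal rule [qbinomS]. *)
Lemma q_binomial (x : C) n :
  \prod_(j < n) (1 + x * q ^+ j)
    = \sum_(m < n.+1) q ^+ 'C(m, 2) * qbinom q n m * x ^+ m.
Proof.
elim: n => [|n IH]; first by rewrite big_ord0 big_ord1 qbinom0 !mulr1.
rewrite big_ord_recr /= IH mulrDr mulr1 [X in X + _]big_ord_recl
  /= [RHS]big_ord_recl /=.
rewrite !qbinom0 -addrA; congr (_ + _).
under [in RHS]eq_bigr => m _.
  rewrite /bump /= add1n qbinomS; last by rewrite -ltnS.
  rewrite mulrDr mulrDl.
  over.
rewrite big_split /=; congr (_ + _).
  by rewrite big_ord_recr /= qbinom_small // mulr0 mul0r addr0.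
rewrite mulr_suml; apply: eq_bigr => -[m mn] _ /=.
have -> : q ^+ n = q ^+ m * q ^+ (n - m) by rewrite -exprD subnKC // -ltnS.
by rewrite binS bin1 exprD exprS; ring.
Qed.

Lemma qbinom_trinom N n m : (n + m <= N)%N ->
  qbinom q N (n + m) * qbinom q (n + m) n = qbinom q N n * qbinom q (N - n) m.
Proof.
move=> nmN; rewrite -(subnKC nmN); set d := (N - _)%N.
rewrite !qbinomD -addnA addKn !qbinomD.
by field; rewrite !qpoch_neq0.
Qed.

(** Reindexing of a triangular sum by m = n + k. The vanishing of f beyond M makes
both summation ranges rectangular. *)
Lemma sum_diagonal (f : nat -> nat -> C) M :
  (forall m n, (M <= m)%N -> f m n = 0) ->
  \sum_(m < M) \sum_(n < M | (n <= m)%N) f m n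
    = \sum_(k < M) \sum_(n < M) f (n + k)%N n.
Proof.
move=> f0; rewrite [LHS](exchange_big_dep xpredT) //= [RHS]exchange_big /=.
apply: eq_bigr => -[n nM] _ /=.
rewrite -(big_mkord (fun m => n <= m)%N (fun m => f m n)).
rewrite -(big_mkord xpredT (fun k => f (n + k)%N n)).
rewrite (big_cat_nat (leq0n n) (ltnW nM)) /= big_nat_cond big_pred0 ?add0r;
  last first.
  by move=> m; lia.
rewrite [RHS](@big_cat_nat _ _ _ (M - n)%N) ?leq_subr //=.
rewrite [X in _ = _ + X]big_nat_cond [X in _ = _ + X]big1 ?addr0; last first.
  by move=> k kP; apply: f0; lia.
rewrite -{1}[n]add0n big_addn big_nat_cond [RHS]big_nat_cond.
by apply: eq_big => [k|k _]; [lia | rewrite addnC].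
Qed.

End FiniteIdentities.

Section FiniteTransformations.
Variable C : numClosedFieldType.
Variable q : C.
Hypothesis qpoch_neq0 : forall n, qpoch q q n != 0.

(** The q-binomial theorem with a summation range M independent of n, the extra
terms being zero. *)
Lemma qpoch_sum (x : C) n M : (n <= M)%N ->
  qpoch (- x) q n = \sum_(m < M.+1) q ^+ 'C(m, 2) * qbinom q n m * x ^+ m.
Proof.
move=> nM; rewrite /qpoch; under eq_bigr do rewrite mulNr opprK.
pose t m := q ^+ 'C(m, 2) * qbinom q n m * x ^+ m.
rewrite q_binomial // -(big_mkord xpredT t) -[in RHS](big_mkord xpredT t).
rewrite [RHS](big_cat_nat (leq0n n.+1)) //= [X in _ + X]big_nat_cond.
rewrite [X in _ + X]big1 ?addr0 // => m /andP[/andP[nm _] _].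
by rewrite /t qbinom_small // mulr0 mul0r.
Qed.

(** A finite form of the limiting case 1phi1(z; 0; q, w) of Heine's
transformation. Expanding (z)_i on the left and (w q^n)_(N-n) on the right by
the q-binomial theorem gives the same double sum, with i = n + m: the exponents
agree by 'C(n + m, 2) = 'C(n, 2) + 'C(m, 2) + n m, and the coefficients by the
trinomial revision [qbinom_trinom]. *)
Lemma finite_heine (w z : C) N :
  \sum_(i < N.+1) (-1) ^+ i * q ^+ 'C(i, 2) * w ^+ i * qpoch z q i * qbinom q N i
  = \sum_(n < N.+1) z ^+ n * q ^+ ('C(n, 2) + 'C(n, 2)) * w ^+ n
      * qpoch (w * q ^+ n) q (N - n) * qbinom q N n.
Proof.
pose f i n : C := (-1) ^+ i * q ^+ 'C(i, 2) * w ^+ i * qbinom q N i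
  * (q ^+ 'C(n, 2) * qbinom q i n * (- z) ^+ n).
transitivity (\sum_(i < N.+1) \sum_(n < N.+1 | (n <= i)%N) f i n).
  apply: eq_bigr => -[i iN] _ /=; rewrite -[z in LHS]opprK (@qpoch_sum _ _ N) //.
  rewrite mulrAC mulr_sumr [RHS]big_mkcond; apply: eq_bigr => n _ /=.
  case: leqP => [_ | ni]; first exact: erefl.
  by rewrite (qbinom_small _ ni) mulr0 mul0r mulr0.
rewrite sum_diagonal; last first.
  by move=> m n Nm; rewrite /f [qbinom q N m]qbinom_small // mulr0 mul0r.
rewrite exchange_big; apply: eq_bigr => -[n nN] _ /=.
rewrite -[w * _ in RHS]opprK (@qpoch_sum _ _ N) ?leq_subr //.
rewrite mulrAC mulr_sumr; apply: eq_bigr => -[m mN] _ /=; rewrite /f.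
have [nmN|Nnm] := leqP (n + m) N; last first.
  rewrite [qbinom q N (n + m)]qbinom_small // [qbinom q (N - n) m]qbinom_small;
    last by lia.
  by rewrite !(mulr0, mul0r).
have tri := qbinom_trinom qpoch_neq0 nmN.
transitivity ((-1) ^+ (n + m) * q ^+ 'C(n + m, 2) * w ^+ (n + m) * q ^+ 'C(n, 2)
  * (- z) ^+ n * (qbinom q N (n + m) * qbinom q (n + m) n)); first by ring.
rewrite tri bin2D !exprD [(- z) ^+ n]exprNn [(- (w * _)) ^+ m]exprNn exprMn -exprM.
have sgn : (-1) ^+ n * (-1) ^+ n = 1 :> C by rewrite -exprMn mulrNN mulr1 expr1n.
transitivity (((-1) ^+ n * (-1) ^+ n)
  * ((-1) ^+ m * (q ^+ 'C(n, 2) * q ^+ 'C(m, 2) * q ^+ (n * m))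
   * (w ^+ n * w ^+ m) * q ^+ 'C(n, 2) * z ^+ n * (qbinom q N n * qbinom q (N - n) m))).
  by ring.
by rewrite sgn; ring.
Qed.

(** The transformation at w = q^(k+2), where (w q^n)_(N-n) is a quotient of
q-factorials. *)
Lemma finite_coefficient (z : C) k N :
  \sum_(i < N.+1) (-1) ^+ i * q ^+ (triangular (i + k) + i) * qpoch z q i
      * qbinom q N i
  = \sum_(n < N.+1) z ^+ n * q ^+ (triangular n + triangular (n + k))
      * qbinom q N n * (qpoch q q (N + k).+1 / qpoch q q (n + k).+1).
Proof.
have /(congr1 (fun v => q ^+ triangular k * v)) := finite_heine (q ^+ k.+2) z N.
rewrite !mulr_sumr => eqN.
transitivity (\sum_(i < N.+1) q ^+ triangular k *
    ((-1) ^+ i * q ^+ 'C(i, 2) * (q ^+ k.+2) ^+ i * qpoch z q i * qbinom q N i)).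
  apply: eq_bigr => i _.
  have -> : (triangular (i + k) + i = triangular k + ('C(i, 2) + k.+2 * i))%N.
    by rewrite triangularD [triangular i]triangular_bin; lia.
  by rewrite -exprM [q ^+ (triangular k + _)]exprD [q ^+ ('C(i, 2) + _)]exprD; ring.
rewrite eqN; apply: eq_bigr => -[n nN] _ /=.
have -> : (triangular n + triangular (n + k)
    = triangular k + ('C(n, 2) + 'C(n, 2) + k.+2 * n))%N.
  by rewrite triangularD [triangular n]triangular_bin; lia.
have -> : ((N + k).+1 = (n + k).+1 + (N - n))%N by lia.
rewrite qpochD [_ / qpoch q q _]mulrAC mulfV // mul1r -exprD -exprS.
have -> : ((n + k).+1.+1 = k.+2 + n)%N by lia.
rewrite -exprM [q ^+ (triangular k + _)]exprD.
by rewrite [q ^+ ('C(n, 2) + 'C(n, 2) + _)]exprD; ring.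
Qed.

(** The coefficient of A^k, and of B^k, in (-Aq)_M (-Bq)_M once products A^n B^n
are written z^n. *)
Definition finite_bessel (z : C) k M : C :=
  \sum_(n < M.+1) z ^+ n * q ^+ (triangular n + triangular (n + k))
    * qbinom q M n * qbinom q M (n + k).

(** The pairs n <= m give the powers of A, the pairs m <= n the powers of B, and
the diagonal, counted in both, is subtracted. *)
Lemma finite_product (A B : C) M :
  qpoch (- A * q) q M * qpoch (- B * q) q M
  = \sum_(k < M.+1) finite_bessel (A * B) k M * A ^+ k
    + \sum_(k < M.+1) finite_bessel (A * B) k M * B ^+ k
    - finite_bessel (A * B) 0 M.
Proof.
pose a x m : C := q ^+ triangular m * qbinom q M m * x ^+ m.
have poch x : qpoch (- x * q) q M = \sum_(m < M.+1) a x m.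
  rewrite mulNr (@qpoch_sum _ _ M) //; apply: eq_bigr => m _.
  by rewrite /a triangular_bin exprD exprMn; ring.
have diag x y : \sum_(m < M.+1) \sum_(n < M.+1 | (n <= m)%N) a x m * a y n
    = \sum_(k < M.+1) finite_bessel (x * y) k M * x ^+ k.
  rewrite (sum_diagonal (f := fun m n => a x m * a y n)); last first.
    by move=> m n Mm; rewrite /a qbinom_small // !(mulr0, mul0r).
  apply: eq_bigr => k _; rewrite mulr_suml; apply: eq_bigr => n _.
  by rewrite /a exprMn !exprD; ring.
rewrite !poch -diag [A * B]mulrC -diag.
have -> : finite_bessel (B * A) 0 M
    = \sum_(m < M.+1) \sum_(n < M.+1 | n == m) a A m * a B n.
  apply: eq_bigr => m _; rewrite big_pred1_eq /a addn0 exprMn exprD.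
  by ring.
rewrite [X in _ + X - _](exchange_big_dep xpredT) //= mulr_suml -big_split /= -sumrB.
apply: eq_bigr => m _; rewrite mulr_sumr.
rewrite [X in _ = X + _ - _]big_mkcond [X in _ = _ + X - _]big_mkcond.
rewrite [X in _ = _ - X]big_mkcond -big_split /= -sumrB.
apply: eq_bigr => n _; rewrite [a B _ * _]mulrC -val_eqE /=.
by case: ltngtP => _; rewrite ?(addr0, add0r, subr0) // addrK.
Qed.

End FiniteTransformations.

(** * Estimates for q-factorials *)

Section QEstimates.
Variable C : numClosedFieldType.
Hypothesis completeC : geometric_complete C.
Variable q : C.
Hypothesis q_lt1 : `|q| < 1.

(** The quotient of consecutive terms of |q|^(T_n) (2 a)^n is 2 a |q|^(n+1),
eventually below 1, so that this sequence is bounded. *)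
Lemma gauss_dominated (a : C) : 0 <= a ->
  exists2 K, 0 <= K & forall n, `|q| ^+ triangular n * a ^+ n <= K * 2^-1 ^+ n.
Proof.
move=> a0.
pose f n := `|q| ^+ triangular n * a ^+ n * 2 ^+ n.
have f0 n : 0 <= f n by rewrite /f !mulr_ge0 ?exprn_ge0.
have [m _ mP] : \forall n \near \oo, a * 2 * `|q| ^+ n < 1.
  by apply: geometric_small => //; rewrite ?normr_ge0 ?mulr_ge0.
exists (\sum_(i < m.+1) f i) => [|n]; first exact: sumr_ge0.
suff fn : f n <= \sum_(i < m.+1) f i.
  by rewrite exprVn ler_pdivlMr ?exprn_gt0.
have [nm|mn] := leqP n m.
  have nm' : (n < m.+1)%N by [].
  by rewrite (bigD1 (Ordinal nm')) //= lerDl sumr_ge0.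
rewrite -(subnKC (ltnW mn)); elim: (n - m)%N => [|d IH].
  by rewrite addn0 (bigD1 ord_max) //= lerDl sumr_ge0.
apply: le_trans IH; rewrite addnS.
have -> : f (m + d).+1 = f (m + d)%N * (a * 2 * `|q| ^+ (m + d).+1).
  by rewrite /f triangularS exprD [a ^+ _.+1]exprS [2 ^+ _.+1]exprS; ring.
rewrite ler_piMr // ltW //; apply: mP => /=; lia.
Qed.

(** The product p_n of the 1 - |q|^(j+1) has a positive lower bound: its factors
past a large m have product at least 1/2. It bounds |(q)_n| from below, and
1 / p_n bounds it from above since (1 - u)(1 + u) <= 1. *)
Lemma qpoch_bounds :
  exists2 d : C, 0 < d & forall n, d <= `|qpoch q q n| <= d^-1.
Proof.
pose r := `|q|; have r0 : 0 <= r by exact: normr_ge0.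
have r01 : 0 <= r < 1 by rewrite r0.
have r1 : 0 < 1 - r by rewrite subr_gt0.
pose p n : C := \prod_(j < n) (1 - r ^+ j.+1).
have pS n : p n.+1 = p n * (1 - r ^+ n.+1) by rewrite /p big_ord_recr.
have fac n : 0 < 1 - r ^+ n.+1 <= 1.
  by rewrite subr_gt0 exprn_ilt1 // gerBl exprn_ge0.
have p0 n : 0 < p n by apply: prodr_gt0 => j _; case/andP: (fac j).
have p_mono m n : (m <= n)%N -> p n <= p m.
  move=> /subnKC <-; elim: (n - m)%N => [|d IH]; first by rewrite addn0.
  apply: le_trans IH; rewrite addnS pS ler_piMr ?(ltW (p0 _)) //.
  by case/andP: (fac (m + d)%N).
have e0 : 0 < 2^-1 * (1 - r) :> C by rewrite mulr_gt0 // invr_gt0.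
have [m _ /(_ _ (leqnn m)) /= mP] := geometric_small completeC r01 ler01 e0.
rewrite mul1r -ltr_pdivrMr // in mP.
(* Weierstrass: a product of factors 1 - u is at least 1 minus the sum of the u. *)
have weier n : p m * (1 - \sum_(m <= j < m + n) r ^+ j.+1) <= p (m + n)%N.
  elim: n => [|n IH]; first by rewrite addn0 big_geq // subr0 mulr1.
  rewrite addnS pS big_nat_recr ?leq_addr //=.
  apply: le_trans (ler_wpM2r _ IH); last by case/andP: (fac (m + n)%N) => /ltW.
  rewrite -mulrA ler_pM2l //.
  set s := \sum_(_ <= _ < _) _; set u := r ^+ _.
  have -> : (1 - s) * (1 - u) = 1 - (s + u) + s * u by ring.
  rewrite lerDl mulr_ge0 ?exprn_ge0 //.
  by apply: sumr_ge0 => j _; rewrite exprn_ge0.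
have low n : p m / 2 <= p n.
  have half : p m / 2 <= p (m + n)%N.
    apply: le_trans (weier n); rewrite ler_pM2l //.
    rewrite [X in X <= _](_ : _ = 1 - 2^-1) ?lerD2l ?lerN2; last first.
      by field.
    apply: le_trans (ltW mP); apply: le_trans (geometric_tail m (m + n) r01).
    apply: ler_sum => j _; rewrite exprS ler_piMl ?exprn_ge0 // ltW //.
  by apply: le_trans half _; apply: p_mono; rewrite leq_addl.
exists (p m / 2) => [|n]; first by rewrite divr_gt0.
apply/andP; split.
  apply: le_trans (low n) _; rewrite /qpoch normr_prod; apply: ler_prod => j _.
  rewrite ltW; last by case/andP: (fac j).
  by rewrite -exprS -normrX -[X in X - _]normr1 lerB_dist.
rewrite -[leRHS]mulr1 ler_pdivlMl ?divr_gt0 //.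
apply: le_trans (ler_wpM2r (normr_ge0 _) (low n)) _.
rewrite /qpoch normr_prod -big_split /=; apply: prodr_ile1 => j _.
have [/ltW f0 _] := andP (fac j).
rewrite mulr_ge0 //= -exprS.
apply: (le_trans (y := (1 - r ^+ j.+1) * (1 + r ^+ j.+1))).
  rewrite ler_wpM2l // (le_trans (ler_normB _ _)) // normr1 normrX //.
by rewrite -subr_sqr expr1n gerBl exprn_ge0 // exprn_ge0.
Qed.

Lemma qpoch_qq_neq0 n : qpoch q q n != 0.
Proof.
have [d d0 dP] := qpoch_bounds; have /andP[dn _] := dP n.
by rewrite -normr_gt0 (lt_le_trans d0).
Qed.

(** The increments - (q)_n q^(n+1) are geometrically dominated. *)
Lemma qpoch_qq_cvg : qpoch q q @ \oo --> qpoch_inf q q.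
Proof.
have [d d0 dP] := qpoch_bounds.
pose x n := qpoch q q n.+1 - qpoch q q n.
suff cv : cvgn (series x).
  have cv' : series x n + 1 @[n --> \oo] --> limn (series x) + 1.
    by apply: cvgD; [exact: cv | exact: cvg_cst].
  suff xE : qpoch q q = fun n => series x n + 1.
    by rewrite -xE in cv'; rewrite /qpoch_inf; apply/cvgP: cv'.
  apply/funext => n; rewrite /series /= /x telescope_sumr // qpoch0 subrK //.
apply: (completeC (K := d^-1 * `|q|) (r := `|q|)); first by rewrite normr_ge0.
move=> n; rewrite /x qpochS mulrBr mulr1 addrC addKr normrN normrM.
rewrite -exprS normrX exprS mulrA !ler_wpM2r ?exprn_ge0 //.
by case/andP: (dP n).
Qed.

Lemma qbinom_bounded : exists2 K : C, 0 <= K & forall n m, `|qbinom q n m| <= K.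
Proof.
have [d d0 dP] := qpoch_bounds.
exists (d^-1 * (d^-1 * d^-1)) => [|n m].
  by rewrite !mulr_ge0 ?invr_ge0 ?ltW.
rewrite /qbinom; case: leqP => _; last by rewrite normr0 !mulr_ge0 ?invr_ge0 ?ltW.
have inv k : `|qpoch q q k|^-1 <= d^-1.
  by rewrite lef_pV2 ?posrE // ?normr_gt0 ?qpoch_qq_neq0 //; case/andP: (dP k).
rewrite normrM normfV normrM invfM.
rewrite ler_pM ?mulr_ge0 ?invr_ge0 //; first by case/andP: (dP n).
by rewrite ler_pM ?invr_ge0.
Qed.

Lemma qbinom_cvg m : (qbinom q) ^~ m @ \oo --> (qpoch q q m)^-1.
Proof.
have cv := qpoch_qq_cvg.
have inf0 : qpoch_inf q q != 0.
  have [d d0 dP] := qpoch_bounds.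
  apply/eqP => i0; rewrite i0 in cv.
  have /cvgr0Pnorm_lt /(_ d d0) [n _ /(_ n (leqnn n))] := cv.
  by case/andP: (dP n) => dn _ /(le_lt_trans dn); rewrite ltxx.
rewrite -(cvg_shiftn m).
have -> : (fun n => qbinom q (n + m) m)
    = (fun n => qpoch q q (n + m) * ((qpoch q q m)^-1 * (qpoch q q n)^-1)).
  by apply/funext => n; rewrite addnC qbinomD invfM.
have lim : (fun n => qpoch q q (n + m) * ((qpoch q q m)^-1 * (qpoch q q n)^-1))
    @ \oo --> qpoch_inf q q * ((qpoch q q m)^-1 * (qpoch_inf q q)^-1).
  apply: cvgM; first by rewrite (cvg_shiftn m).
  by apply: cvgMl_tmp; apply: cvgV.
by rewrite mulrCA mulfV // mulr1 in lim.
Qed.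

End QEstimates.

(** * The identities in the limit *)

Section Limits.
Variable C : numClosedFieldType.
Hypothesis completeC : geometric_complete C.
Variable q : C.
Hypothesis q_lt1 : `|q| < 1.

Let h01 : 0 <= (2^-1 : C) < 1.
Proof. by rewrite invr_ge0 ler0n invf_lt1 ?ltr0n // ltr1n. Qed.

Let q_neq0 n : qpoch q q n != 0.
Proof. exact: qpoch_qq_neq0. Qed.

Lemma gauss_dominated2 (a b : C) : 0 <= a -> 0 <= b ->
  exists2 K : C, 0 <= K & forall n k m, (triangular n + triangular k <= m)%N ->
    `|q| ^+ m * a ^+ n * b ^+ k <= K * 2^-1 ^+ n * 2^-1 ^+ k.
Proof.
move=> a0 b0; have [Ka Ka0 KaP] := gauss_dominated completeC q_lt1 a0.
have [Kb Kb0 KbP] := gauss_dominated completeC q_lt1 b0.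
exists (Ka * Kb) => [|n k m nkm]; first exact: mulr_ge0.
apply: (le_trans (y := (`|q| ^+ triangular n * a ^+ n)
    * (`|q| ^+ triangular k * b ^+ k))).
  rewrite mulrACA -exprD -mulrA ler_wpM2r ?mulr_ge0 ?exprn_ge0 ?invr_ge0 //.
  by rewrite ler_wiXn2l // ltW.
have -> : Ka * Kb * 2^-1 ^+ n * 2^-1 ^+ k = (Ka * 2^-1 ^+ n) * (Kb * 2^-1 ^+ k).
  by ring.
by rewrite ler_pM ?mulr_ge0 ?exprn_ge0 ?invr_ge0.
Qed.

Lemma norm_qpoch_le (z : C) n : `|qpoch z q n| <= (1 + `|z|) ^+ n.
Proof.
rewrite /qpoch normr_prod -[in leRHS](card_ord n) -prodr_const.
apply: ler_prod => j _; rewrite normr_ge0 /=.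
apply: le_trans (ler_normB _ _) _; rewrite normr1 lerD2l normrM normrX.
by rewrite ler_piMr // exprn_ile1 // ltW.
Qed.

Lemma inv_qpoch_bounded :
  exists2 K : C, 0 <= K & forall n, `|(qpoch q q n)^-1| <= K.
Proof.
have [K K0 KP] := qbinom_bounded completeC q_lt1.
exists K => // n; apply: (norm_cvg_le (qbinom_cvg completeC q_lt1 (m := n))).
by near=> N; exact: KP.
Unshelve. all: by end_near. Qed.

Definition coef_term (z : C) k i : C :=
  (-1) ^+ i * q ^+ (triangular (i + k) + i) * (qpoch z q i / qpoch q q i).
Definition coef z k : C := limn (series (coef_term z k)).

Definition bessel_term (z : C) k n : C :=
  z ^+ n * q ^+ (triangular n + triangular (n + k))
    / (qpoch q q n * qpoch q q (n + k)).
Definition bessel z k : C := limn (series (bessel_term z k)).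

Lemma triangular_split i k :
  (triangular i + triangular k <= triangular (i + k))%N.
Proof. by rewrite triangularD leq_addr. Qed.

Lemma triangular_le i k : (triangular k <= triangular (i + k))%N.
Proof. by apply: leq_trans (triangular_split i k); exact: leq_addl. Qed.

(** The factor u stands for 1 / (q)_i or for a q-binomial coefficient tending to
it, so that one estimate serves the finite sums and their limit. *)
Lemma coef_dominated (z x : C) : exists2 K : C, 0 <= K & forall u i k,
  `|(-1) ^+ i * q ^+ (triangular (i + k) + i) * (qpoch z q i * u) * x ^+ k|
    <= K * `|u| * 2^-1 ^+ i * 2^-1 ^+ k.
Proof.
have z0 : 0 <= 1 + `|z| by rewrite addr_ge0.
have [K K0 KP] := gauss_dominated2 z0 (normr_ge0 x).
exists K => // u i k; rewrite !normrM !normrX normrN normr1 expr1n mul1r.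
set m := (_ + i)%N; have mP : (triangular i + triangular k <= m)%N.
  by apply: leq_trans (triangular_split i k) _; exact: leq_addr.
have -> : `|q| ^+ m * (`|qpoch z q i| * `|u|) * `|x| ^+ k
    = `|q| ^+ m * `|qpoch z q i| * `|x| ^+ k * `|u| by ring.
have -> : K * `|u| * 2^-1 ^+ i * 2^-1 ^+ k = K * 2^-1 ^+ i * 2^-1 ^+ k * `|u|.
  by ring.
rewrite ler_wpM2r //; apply: le_trans (KP _ _ _ mP).
by rewrite ler_wpM2r ?exprn_ge0 // ler_wpM2l ?exprn_ge0 // norm_qpoch_le.
Qed.

Lemma bessel_dominated (z x : C) : exists2 K : C, 0 <= K & forall u n k,
  `|z ^+ n * q ^+ (triangular n + triangular (n + k)) * u * x ^+ k|
    <= K * `|u| * 2^-1 ^+ n * 2^-1 ^+ k.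
Proof.
have [K K0 KP] := gauss_dominated2 (normr_ge0 z) (normr_ge0 x).
exists K => // u n k; rewrite !normrM !normrX.
set m := (_ + _)%N; have mP : (triangular n + triangular k <= m)%N.
  by rewrite leq_add2l triangular_le.
have -> : `|z| ^+ n * `|q| ^+ m * `|u| * `|x| ^+ k
    = `|q| ^+ m * `|z| ^+ n * `|x| ^+ k * `|u| by ring.
have -> : K * `|u| * 2^-1 ^+ n * 2^-1 ^+ k = K * 2^-1 ^+ n * 2^-1 ^+ k * `|u|.
  by ring.
by rewrite ler_wpM2r //; exact: KP.
Qed.

Lemma coef_term_dominated (z x : C) : exists2 K : C, 0 <= K & forall i k,
  `|coef_term z k i * x ^+ k| <= K * 2^-1 ^+ i * 2^-1 ^+ k.
Proof.
have [K K0 KP] := coef_dominated z x; have [L L0 LP] := inv_qpoch_bounded.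
exists (K * L) => [|i k]; first exact: mulr_ge0.
apply: le_trans (KP _ i k) _.
by rewrite !ler_wpM2r ?exprn_ge0 ?invr_ge0 // ler_wpM2l.
Qed.

Lemma bessel_term_dominated (z x : C) : exists2 K : C, 0 <= K & forall n k,
  `|bessel_term z k n * x ^+ k| <= K * 2^-1 ^+ n * 2^-1 ^+ k.
Proof.
have [K K0 KP] := bessel_dominated z x; have [L L0 LP] := inv_qpoch_bounded.
exists (K * (L * L)) => [|n k]; first by rewrite !mulr_ge0.
apply: le_trans (KP _ n k) _.
rewrite !ler_wpM2r ?exprn_ge0 ?invr_ge0 // ler_wpM2l // invfM normrM.
by rewrite ler_pM.
Qed.

Lemma coef_cvg z k : series (coef_term z k) @ \oo --> coef z k.
Proof.
have [K K0 KP] := coef_term_dominated z 1.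
apply: (completeC (K := K * 2^-1 ^+ k) h01) => i.
by have := KP i k; rewrite expr1n mulr1 mulrAC.
Qed.

Lemma bessel_cvg z k : series (bessel_term z k) @ \oo --> bessel z k.
Proof.
have [K K0 KP] := bessel_term_dominated z 1.
apply: (completeC (K := K * 2^-1 ^+ k) h01) => i.
by have := KP i k; rewrite expr1n mulr1 mulrAC.
Qed.

(** Let N tend to infinity in [finite_coefficient]; the right-hand limit has the
terms z^n q^(T_n + T_(n+k)) (q)_oo / ((q)_n (q)_(n+k+1)), and
q^(T_m) / (q)_(m+1) = q^(T_m) / (q)_m + q^(T_(m+1)) / (q)_(m+1) with m = n + k. *)
Lemma coef_bessel z k :
  coef z k = qpoch_inf q q * (bessel z k + bessel z k.+1).
Proof.
have [B B0 BP] := qbinom_bounded completeC q_lt1.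
pose x N i := (-1) ^+ i * q ^+ (triangular (i + k) + i)
  * (qpoch z q i * qbinom q N i).
have lhs : (fun N => \sum_(i < N.+1) x N i) @ \oo --> coef z k.
  have [K K0 KP] := coef_dominated z 1.
  apply: (tannery completeC (h := succn) (K := K * B * 2^-1 ^+ k) h01) => //.
    move=> N i; have := KP (qbinom q N i) i k; rewrite expr1n mulr1 => /le_trans.
    apply; rewrite mulrAC !ler_wpM2r ?exprn_ge0 ?invr_ge0 //.
    by rewrite ler_wpM2l.
  by move=> i; apply: cvgMl_tmp; apply: cvgMl_tmp; exact: qbinom_cvg.
pose y N n := z ^+ n * q ^+ (triangular n + triangular (n + k))
  * (qbinom q N n * (qpoch q q (N + k).+1 / qpoch q q (n + k).+1)).
pose w n := z ^+ n * q ^+ (triangular n + triangular (n + k))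
  * ((qpoch q q n)^-1 * (qpoch_inf q q / qpoch q q (n + k).+1)).
have rhs : (fun N => \sum_(n < N.+1) y N n) @ \oo --> limn (series w).
  have [K K0 KP] := bessel_dominated z 1.
  have [d d0 dP] := qpoch_bounds completeC q_lt1.
  have [L L0 LP] := inv_qpoch_bounded.
  apply: (tannery completeC (h := succn) (K := K * (B * (d^-1 * L)) * 2^-1 ^+ k)
      h01) => //.
    move=> N n.
    have := KP (qbinom q N n * (qpoch q q (N + k).+1 / qpoch q q (n + k).+1)) n k.
    rewrite expr1n mulr1 => /le_trans; apply.
    rewrite mulrAC !ler_wpM2r ?exprn_ge0 ?invr_ge0 //.
    rewrite ler_wpM2l // normrM ler_pM // normrM ler_pM //.
    by case/andP: (dP (N + k).+1).
  move=> n; apply: cvgMl_tmp; apply: cvgM; first exact: qbinom_cvg.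
  apply: cvgMr_tmp.
  rewrite (cvg_shiftS (fun N => qpoch q q (N + k))) (cvg_shiftn k).
  exact: qpoch_qq_cvg.
have xy : (fun N => \sum_(i < N.+1) x N i) = (fun N => \sum_(n < N.+1) y N n).
  apply/funext => N; have := finite_coefficient q_neq0 z k N.
  rewrite /x /y; under eq_bigr do rewrite -mulrA.
  by under [in X in _ = X -> _]eq_bigr do rewrite -mulrA.
rewrite xy in lhs; rewrite -(cvg_lim _ lhs) // (cvg_lim _ rhs) //.
apply: cvg_lim => //.
have -> : series w = fun N => qpoch_inf q q
    * (series (bessel_term z k) N + series (bessel_term z k.+1) N).
  apply/funext => N; rewrite /series /= -big_split mulr_sumr /=.
  apply: eq_bigr => n _; rewrite /w /bessel_term addnS.
  have := q_neq0 (n + k).+1; rewrite triangularS !addnA qpochS -exprS.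
  rewrite mulf_eq0 negb_or => /andP[n1 n2].
  by rewrite [q ^+ (_ + (n + k).+1)]exprD; field; rewrite n1 n2 q_neq0.
by apply: cvgMl_tmp; apply: cvgD; exact: bessel_cvg.
Qed.

Definition bessel_gen (z x : C) : C := limn (series (fun k => bessel z k * x ^+ k)).

Definition coef_gen (z x : C) : C := limn (series (fun k => coef z k * x ^+ k)).

Lemma lim_seriesMr (t : nat -> C) (u : C) : cvgn (series t) ->
  limn (series t) * u = limn (series (fun n => t n * u)).
Proof.
move=> cv; apply/esym/cvg_lim => //.
have -> : series (fun n => t n * u) = fun N => series t N * u.
  by apply/funext => N; rewrite /series /= mulr_suml.
exact: cvgMr_tmp.
Qed.

Lemma dominated_gen_cvg (t : nat -> nat -> C) (K x : C) :
  (forall k, cvgn (series (t k))) ->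
  (forall n k, `|t k n * x ^+ k| <= K * 2^-1 ^+ n * 2^-1 ^+ k) ->
  cvgn (series (fun k => limn (series (t k)) * x ^+ k)).
Proof.
move=> cvt tle; apply: (completeC (K := K / (1 - 2^-1)) h01) => k.
rewrite lim_seriesMr // mulrAC; apply: (dominated_series completeC h01) => n.
by rewrite [leRHS]mulrAC.
Qed.

Lemma bessel_gen_cvg z x :
  series (fun k => bessel z k * x ^+ k) @ \oo --> bessel_gen z x.
Proof.
have [K K0 KP] := bessel_term_dominated z x.
exact: (@dominated_gen_cvg (bessel_term z) K x (@bessel_cvg z) KP).
Qed.

Lemma coef_gen_cvg z x :
  series (fun k => coef z k * x ^+ k) @ \oo --> coef_gen z x.
Proof.
have [K K0 KP] := coef_term_dominated z x.
exact: (@dominated_gen_cvg (coef_term z) K x (@coef_cvg z) KP).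
Qed.

Lemma qpoch_NMq_cvg (x : C) : qpoch (- x * q) q @ \oo --> qpoch_inf (- x * q) q.
Proof.
have [B B0 BP] := qbinom_bounded completeC q_lt1.
have [K K0 KP] := gauss_dominated completeC q_lt1 (normr_ge0 x).
pose a M m := q ^+ triangular m * qbinom q M m * x ^+ m.
pose b m := q ^+ triangular m / qpoch q q m * x ^+ m.
suff cv : qpoch (- x * q) q @ \oo --> limn (series b).
  by rewrite /qpoch_inf; apply/cvgP: cv.
have -> : qpoch (- x * q) q = fun M => \sum_(m < M.+1) a M m.
  apply/funext => M; rewrite mulNr (@qpoch_sum _ _ q_neq0 _ _ M) //.
  by apply: eq_bigr => m _; rewrite /a triangular_bin exprD exprMn; ring.
apply: (tannery completeC (h := succn) (K := K * B) h01) => // [M m|m].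
  rewrite /a !normrM !normrX mulrAC mulrAC [K * B * _]mulrAC.
  by rewrite [_ * `|x| ^+ m]mulrAC ler_pM ?mulr_ge0 ?exprn_ge0 ?invr_ge0.
by apply: cvgMr_tmp; apply: cvgMl_tmp; exact: qbinom_cvg.
Qed.

(** Let M tend to infinity in [finite_product]: Tannery's theorem applies first to
each coefficient, then to the power series that they form. *)
Lemma product_expansion (A B : C) :
  qpoch_inf (- A * q) q * qpoch_inf (- B * q) q
  = bessel_gen (A * B) A + bessel_gen (A * B) B - bessel (A * B) 0.
Proof.
have [L L0 LP] := qbinom_bounded completeC q_lt1.
set z := A * B.
have cv1 k : finite_bessel q z k @ \oo --> bessel z k.
  have [K K0 KP] := bessel_dominated z 1.
  pose x M n := z ^+ n * q ^+ (triangular n + triangular (n + k))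
    * (qbinom q M n * qbinom q M (n + k)).
  have -> : finite_bessel q z k = fun M => \sum_(n < M.+1) x M n.
    by apply/funext => M; apply: eq_bigr => n _; rewrite /x mulrA.
  apply: (tannery completeC (h := succn) (K := K * (L * L) * 2^-1 ^+ k) h01) => //.
    move=> M n; have := KP (qbinom q M n * qbinom q M (n + k)) n k.
    rewrite expr1n mulr1 => /le_trans; apply.
    rewrite mulrAC !ler_wpM2r ?exprn_ge0 ?invr_ge0 //.
    by rewrite ler_wpM2l // normrM ler_pM.
  move=> n; apply: cvgMl_tmp; rewrite invfM.
  by apply: cvgM; exact: qbinom_cvg.
have cv2 x : (fun M => \sum_(k < M.+1) finite_bessel q z k M * x ^+ k) @ \oo
    --> bessel_gen z x.
  have [K K0 KP] := bessel_dominated z x.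
  apply: (tannery completeC (h := succn)
    (x := fun M k => finite_bessel q z k M * x ^+ k)
    (K := K * (L * L) / (1 - 2^-1)) h01) => // [M k|k]; last first.
    by apply: cvgMr_tmp; exact: cv1.
  rewrite /finite_bessel mulr_suml mulrAC.
  pose u n := z ^+ n * q ^+ (triangular n + triangular (n + k))
    * qbinom q M n * qbinom q M (n + k) * x ^+ k.
  rewrite -(big_mkord xpredT u).
  have := @dominated_sum _ u (K * (L * L) * 2^-1 ^+ k) 2^-1 0 M.+1 h01.
  rewrite expr0 mulr1; apply => n.
  have := KP (qbinom q M n * qbinom q M (n + k)) n k.
  rewrite /u mulrA => /le_trans; apply.
  rewrite mulrAC !ler_wpM2r ?exprn_ge0 ?invr_ge0 //.
  by rewrite ler_wpM2l // normrM ler_pM.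
have prod : (fun M => qpoch (- A * q) q M * qpoch (- B * q) q M) @ \oo
    --> qpoch_inf (- A * q) q * qpoch_inf (- B * q) q.
  by apply: cvgM; exact: qpoch_NMq_cvg.
rewrite -(cvg_lim _ prod) //; apply: cvg_lim => //.
under eq_fun do rewrite finite_product //.
by apply: cvgB; [apply: cvgD; exact: cv2 | exact: cv1].
Qed.

(** Termwise, x c_j x^j = (q)_oo (x b_j x^j + b_(j+1) x^(j+1)), and the second
part sums to D(x) - b_0. Multiplying by x avoids a division when x = 0. *)
Lemma coef_gen_bessel (z x : C) :
  x * coef_gen z x
  = qpoch_inf q q * ((1 + x) * bessel_gen z x - bessel z 0).
Proof.
have gen := bessel_gen_cvg (z := z) (x := x).
pose s := series (fun k => bessel z k * x ^+ k).
have rhs : (fun N => qpoch_inf q q * (x * s N + (s N.+1 - bessel z 0))) @ \oo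
    --> qpoch_inf q q * (x * bessel_gen z x + (bessel_gen z x - bessel z 0)).
  apply: cvgMl_tmp; apply: cvgD; first by apply: cvgMl_tmp.
  by apply: cvgB; [rewrite (cvg_shiftS s) | exact: cvg_cst].
have eqs : (fun N => x * series (fun k => coef z k * x ^+ k) N)
    = (fun N => qpoch_inf q q * (x * s N + (s N.+1 - bessel z 0))).
  apply/funext => N; rewrite /s /series /=.
  rewrite [in RHS]big_nat_recl // mulr1 addrAC subrr add0r !mulr_sumr.
  rewrite -big_split /= mulr_sumr; apply: eq_bigr => k _.
  by rewrite coef_bessel exprS; ring.
rewrite -eqs in rhs.
have cv : (fun N => x * series (fun k => coef z k * x ^+ k) N) @ \oo
    --> x * coef_gen z x.
  by apply: cvgMl_tmp; exact: coef_gen_cvg.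
rewrite -(cvg_lim _ cv) // (cvg_lim _ rhs) //; ring.
Qed.

Lemma coef_genN1 (z : C) : coef_gen z (-1) = qpoch_inf q q * bessel z 0.
Proof.
have := coef_gen_bessel z (-1).
by rewrite subrr mul0r sub0r mulN1r mulrN => /oppr_inj.
Qed.

(** The terms are dominated by K 2^-i 2^-j since T_i + T_j <= T_(i+j). *)
Lemma coef_unordered (z x : C) :
  partial_sum (fun ij => coef_term z ij.2 ij.1 * x ^+ ij.2) @ totally
    --> coef_gen z x.
Proof.
have [K K0 KP] := coef_term_dominated z x.
have := unordered_iterated completeC h01
  (f := fun ij => coef_term z ij.2 ij.1 * x ^+ ij.2) KP.
rewrite /=; suff -> : (fun j => limn (series (fun i => coef_term z j i * x ^+ j)))
    = (fun j => coef z j * x ^+ j) by [].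
by apply/funext => j; rewrite -lim_seriesMr //; exact: coef_cvg.
Qed.

End Limits.

(** * The double sum *)

(** By linearity, both double sums are combinations of the sums S(x) at x = A, B
and -1; what remains is an identity between rational functions. *)
Theorem double_sum_identity (C : numClosedFieldType)
    (cC : geometric_complete C) (q A B : C)
    (hq : `|q| < 1) (hA : A != -1) (hB : B != -1) :
  let F (ij : nat * nat) : C :=
    let: (i, j) := ij in
    (-1) ^+ i * q ^+ (triangular (i + j) + i)
      * (qpoch (A * B) q i / qpoch q q i)
      * (A ^+ (1 + j) / (1 + A) + B ^+ (1 + j) / (1 + B)) in
  let G (ij : nat * nat) : C :=
    let: (i, j) := ij in
    (-1) ^+ (i + j) * q ^+ (triangular (i + j) + i)
      * (qpoch (A * B) q i / qpoch q q i) in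
  [/\ unordered_cvg F,
      unordered_cvg G &
      unordered_sum F
        + (1 - A * B) / ((1 + A) * (1 + B)) * unordered_sum G
      = qpochs_inf [:: - A * q; - B * q; q] q].
Proof.
move=> F G.
have A1 : 1 + A != 0 by rewrite addrC addr_eq0.
have B1 : 1 + B != 0 by rewrite addrC addr_eq0.
pose z := A * B.
pose U (x : C) (ij : nat * nat) : C := coef_term q z ij.2 ij.1 * x ^+ ij.2.
have cvU x : partial_sum (U x) @ totally --> coef_gen q z x.
  exact: coef_unordered cC q hq z x.
have FE : partial_sum F
    = fun J => A / (1 + A) * partial_sum (U A) J + B / (1 + B) * partial_sum (U B) J.
  apply/funext => J; rewrite /partial_sum !mulr_sumr -big_split /=.
  apply: eq_bigr => p _; case: (val p) => i j.
  rewrite /F /U /coef_term /= !exprS -/z; field.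
  by rewrite A1 B1 (qpoch_qq_neq0 cC hq).
have GE : G = U (-1).
  by apply/funext => -[i j]; rewrite /G /U /coef_term /= exprD; ring.
have cvF : partial_sum F @ totally
    --> (A / (1 + A) * coef_gen q z A + B / (1 + B) * coef_gen q z B).
  by rewrite FE; apply: cvgD; apply: cvgMl_tmp; exact: cvU.
have cvG : partial_sum G @ totally --> coef_gen q z (-1).
  by rewrite GE; exact: cvU.
split; [exact: cvgP cvF | exact: cvgP cvG |].
rewrite /unordered_sum /sum (cvg_lim _ cvF) // (cvg_lim _ cvG) //.
rewrite /qpochs_inf !big_cons big_nil mulr1 mulrA (product_expansion cC hq) -/z.
rewrite (coef_genN1 cC hq).
have gE x : 1 + x != 0 -> x / (1 + x) * coef_gen q z x
    = qpoch_inf q q * (bessel_gen q z x - bessel q z 0 / (1 + x)).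
  by move=> x1; rewrite mulrAC (coef_gen_bessel cC hq); field.
by rewrite !gE // /z; field; rewrite A1 B1.
Qed.

Theorem mainTheorem3 (R : realType) (q A B : R[i])
    (hq : `|q| < 1) (hA : A != -1) (hB : B != -1) :
  let F (ij : nat * nat) : R[i] :=
    let: (i, j) := ij in
    (-1) ^+ i * q ^+ (triangular (i + j) + i)
      * (qpoch (A * B) q i / qpoch q q i)
      * (A ^+ (1 + j) / (1 + A) + B ^+ (1 + j) / (1 + B)) in
  let G (ij : nat * nat) : R[i] :=
    let: (i, j) := ij in
    (-1) ^+ (i + j) * q ^+ (triangular (i + j) + i)
      * (qpoch (A * B) q i / qpoch q q i) in
  [/\ unordered_cvg F,
      unordered_cvg G &
      unordered_sum F
        + (1 - A * B) / ((1 + A) * (1 + B)) * unordered_sum G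
      = qpochs_inf [:: - A * q; - B * q; q] q].
Proof.
exact: double_sum_identity (complex_geometric_complete (R := R)) q A B hq hA hB.
Qed.
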